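(* Let $\lambda>0$, $V=(V^x,V^y)\in\mathbb{R}^2$, $\tilde u=(\tilde u^x,\tilde u^y)\in\mathbb{R}^2$ constant, and $(s_q,s_{xy})\in\mathbb{R}^2$ with $s_q\neq 0$, $s_{xy}\neq 0$. Consider the twisted $D_2Q_4$ scheme relative to $\tilde u$ with relaxation parameters $(0,s_q,s_q,s_{xy})$ and equilibrium moments $$m^{eq}(\tilde u)=\rho\,\big(1,\;V^x-\tilde u^x,\;V^y-\tilde u^y,\;(V^x-\tilde u^x)(V^y-\tilde u^y)\big).$$ Put $\sigma_q=1/s_q-1/2$ and $\sigma_{xy}=1/s_{xy}-1/2$. Then the scheme approaches, at third order in $\Delta t$, the equation $$\partial_t\rho+V\cdot\nabla\rho-\Delta t\,D_2:\nabla^2\rho+\Delta t^2\,D_3:\nabla^3\rho=O(\Delta t^3),$$ where $$D_2=\sigma_q\begin{pmatrix}\lambda^2-(V^x)^2&0\\0&\lambda^2-(V^y)^2\end{pmatrix},$$ $$D_3=\begin{pmatrix}\frac{V^x}{6}(\lambda^2-(V^x)^2)(1-12\sigma_q^2)&2\sigma_q(\lambda^2-(V^y)^2)(\tilde u^x-V^x)(\sigma_q-\sigma_{xy})\\2\sigma_q(\lambda^2-(V^x)^2)(\tilde u^y-V^y)(\sigma_q-\sigma_{xy})&\frac{V^y}{6}(\lambda^2-(V^y)^2)(1-12\sigma_q^2)\end{pmatrix},$$ $$\nabla^2\rho=\begin{pmatrix}\partial_{xx}\rho&\partial_{xy}\rho\\\partial_{xy}\rho&\partial_{yy}\rho\end{pmatrix},\qquad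 \nabla^3\rho=\begin{pmatrix}\partial_{xxx}\rho&\partial_{xyy}\rho\\\partial_{xxy}\rho&\partial_{yyy}\rho\end{pmatrix},$$ and $:$ is the entrywise scalar product of $2\times2$ matrices (viewed as vectors of $\mathbb{R}^4$).
   Context: Twisted $D_2Q_4$ scheme. Let $\Delta x,\Delta t>0$ with $\lambda=\Delta x/\Delta t$ fixed. Velocities: $v_0=(\lambda,\lambda)$, $v_1=(-\lambda,\lambda)$, $v_2=(-\lambda,-\lambda)$, $v_3=(\lambda,-\lambda)$. Moment polynomials: $P_0=1$, $P_1=X$, $P_2=Y$, $P_3=XY$. For $\tilde u\in\mathbb{R}^2$, $M(\tilde u)$ is the invertible $4\times4$ matrix $M(\tilde u)_{kj}=P_k(v_j-\tilde u)$. For a distribution vector $f=(f_0,\dots,f_3)$ put $\rho=\sum_j f_j$ and $m=M(\tilde u)f$. One time step with relaxation parameters $(s_0,\dots,s_3)$ is: relaxation $m_k^*=m_k+s_k(m_k^{eq}-m_k)$, where $m^{eq}$ is a given linear function of $\rho$; $f^*=M(\tilde u)^{-1}m^*$; transport $f_j(x,t+\Delta t)=f_j^*(x-v_j\Delta t,t)$. Meaning of ''approaches at third order'' (equivalent equation, linear case). The relaxation is linear: $f^*=Rf$ with a constant matrix $R$. On plane waves $f(x,t)=e^{ik\cdot x}\hat f(t)$, $k\in\mathbb{R}^2$, a time step multiplies $\hat f$ by $L(k,\Delta t)=\mathrm{diag}(e^{-i\Delta t\,k\cdot v_j})R$. Since $s_q,s_{xy}\ne0$, $1$ is a simple eigenvalue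 of $R=L(k,0)$, so for small $\Delta t$ there is a unique eigenvalue $g(k,\Delta t)$ of $L(k,\Delta t)$ close to $1$. The scheme approaches a linear constant coefficient equation up to $O(\Delta t^3)$ if, for each fixed $k$, replacing $\partial_t$ by $\frac1{\Delta t}\log g(k,\Delta t)$ and $\nabla$ by $ik$ in its left-hand side gives a quantity which is $O(\Delta t^3)$ as $\Delta t\to0$ with $\lambda$ fixed. *)

(* Defs.v *)
From mathcomp Require Import all_boot all_order all_algebra.
From mathcomp Require Import all_classical all_reals all_analysis.
From mathcomp Require Import complex.
From mathcomp Require Import ring.

Set Implicit Arguments.
Unset Strict Implicit.
Unset Printing Implicit Defensive.

Import Order.TTheory GRing.Theory Num.Theory.
Import numFieldNormedType.Exports.

Local Open Scope classical_set_scope.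
Local Open Scope ring_scope.
Local Open Scope complex_scope.

Section Complex.
Context {R : realType}.

Definition expi (t : R) : R[i] := cos t +i* sin t.

(* Argument in ]-pi, pi] (for z = 0 the value is irrelevant). *)
Definition carg (z : R[i]) : R :=
  let: a +i* b := z in
  let t := acos (a / Num.sqrt (a ^+ 2 + b ^+ 2)) in
  if 0 <= b then t else - t.

(* Principal branch of the logarithm. *)
Definition clog (z : R[i]) : R[i] :=
  let: a +i* b := z in
  ln (Num.sqrt (a ^+ 2 + b ^+ 2)) +i* carg z.

Lemma expiD (s t : R) : expi (s + t) = expi s * expi t.
Proof.
by rewrite /expi cosD sinD; apply/eqP; rewrite eq_complex /= eqxx addrC eqxx.
Qed.

Lemma clogK (z : R[i]) : z != 0 ->
  (expR (complex.Re (clog z)))%:C * expi (complex.Im (clog z)) = z.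
Proof.
case: z => a b z0.
have n_gt0 : 0 < a ^+ 2 + b ^+ 2.
  rewrite lt_neqAle addr_ge0 ?sqr_ge0 // andbT eq_sym.
  by rewrite paddr_eq0 ?sqr_ge0 // !sqrf_eq0; move: z0; rewrite eq_complex.
rewrite /clog /carg /=.
set n := Num.sqrt _.
have n0 : 0 < n by rewrite sqrtr_gt0.
have nn : n ^+ 2 = a ^+ 2 + b ^+ 2 by rewrite sqr_sqrtr // ltW.
have an : -1 <= a / n <= 1.
  rewrite -ler_norml normrM normfV (gtr0_norm n0) ler_pdivrMr // mul1r.
  by rewrite -sqrtr_sqr ler_wsqrtr // lerDl sqr_ge0.
have sn : n * Num.sqrt (1 - (a / n) ^+ 2) = `|b|.
  rewrite -[X in X * _](gtr0_norm n0) -sqrtr_sqr -sqrtrM ?sqr_ge0 //.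
  rewrite mulrBr mulr1 -exprMn mulrC divfK ?gt_eqF // nn addrC addKr.
  exact: sqrtr_sqr.
rewrite lnK ?posrE // /expi.
apply/eqP; rewrite eq_complex /= !mul0r subr0 addr0.
have nan : n * (a / n) = a by rewrite mulrC divfK ?gt_eqF.
case: ifP => b0; rewrite ?cosN ?sinN acosK ?in_itv //= sin_acos // ?mulrN.
  by rewrite sn nan ger0_norm // !eqxx.
by rewrite sn nan ltr0_norm ?ltNge ?b0 // opprK !eqxx.
Qed.

End Complex.

Section Scheme.
Context {R : realType}.

Definition dot (k x : R * R) : R := k.1 * x.1 + k.2 * x.2.

Definition velocity (lam : R) (j : 'I_4) : R * R :=
  tnth [tuple (lam, lam); (- lam, lam); (- lam, - lam); (lam, - lam)] j.

Definition moment_poly (k : 'I_4) (p : R * R) : R :=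
  tnth [tuple 1; p.1; p.2; p.1 * p.2] k.

(* Distributions are complex valued, so that plane waves are among them. *)
Definition moment_mx (lam : R) (u : R * R) : 'M[R[i]]_4 :=
  \matrix_(k, j) (moment_poly k (velocity lam j - u))%:C.

Lemma moment_mx_unit (lam : R) (u : R * R) :
  lam != 0 -> moment_mx lam u \in unitmx.
Proof.
move=> lam0.
pose e (j : 'I_4) : R * R := velocity 1 j.
pose N : 'M[R]_4 := \matrix_(j, k) (tnth [tuple
   1 + (e j).1 * u.1 / lam + (e j).2 * u.2 / lam
     + (e j).1 * (e j).2 * u.1 * u.2 / lam ^+ 2;
   (e j).1 / lam + (e j).1 * (e j).2 * u.2 / lam ^+ 2;
   (e j).2 / lam + (e j).1 * (e j).2 * u.1 / lam ^+ 2;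
   (e j).1 * (e j).2 / lam ^+ 2] k / 4).
pose M : 'M[R]_4 := \matrix_(k, j) moment_poly k (velocity lam j - u).
have -> : moment_mx lam u = map_mx (real_complex R) M.
  by apply/matrixP => i j; rewrite !mxE.
rewrite map_unitmx; suff /mulmx1_unit[] : N *m M = 1%:M by [].
apply/matrixP => i j; rewrite !mxE !big_ord_recr big_ord0 /= !mxE /=.
rewrite /moment_poly /velocity /e /velocity.
case: i => -[|[|[|[|//]]]] ?; case: j => -[|[|[|[|//]]]] ?;
  rewrite !(tnth_nth 0) /=; field; rewrite ?lam0 //.
Qed.

(* The equilibrium moments are m^eq = rho *: E. *)
Definition relax (lam : R) (u : R * R) (s E : 4.-tuple R) (f : 'cV[R[i]]_4)
    : 'cV[R[i]]_4 :=
  let M := moment_mx lam u in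
  let rho := \sum_j f j 0 in
  let m := M *m f in
  let meq : 'cV[R[i]]_4 := \col_k (rho * (tnth E k)%:C) in
  let mstar : 'cV[R[i]]_4 :=
    \col_k (m k 0 + (tnth s k)%:C * (meq k 0 - m k 0)) in
  invmx M *m mstar.

Definition time_step (lam : R) (u : R * R) (s E : 4.-tuple R) (dt : R)
    (f : R * R -> 'cV[R[i]]_4) (x : R * R) : 'cV[R[i]]_4 :=
  \col_j relax lam u s E
           (f (x.1 - (velocity lam j).1 * dt, x.2 - (velocity lam j).2 * dt))
           j 0.

Definition relax_mx (lam : R) (u : R * R) (s E : 4.-tuple R) : 'M[R[i]]_4 :=
  \matrix_(i, j) relax lam u s E (delta_mx j 0) i 0.

Definition amplification_mx (lam : R) (u : R * R) (s E : 4.-tuple R)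
    (k : R * R) (dt : R) : 'M[R[i]]_4 :=
  diag_mx (\row_j expi (- (dt * dot k (velocity lam j))))
    *m relax_mx lam u s E.

Definition plane_wave (k : R * R) (fh : 'cV[R[i]]_4) (x : R * R)
  : 'cV[R[i]]_4 := expi (dot k x) *: fh.

Lemma relaxE lam u s E f : relax lam u s E f = relax_mx lam u s E *m f.
Proof.
have relaxD x y :
    relax lam u s E (x + y) = relax lam u s E x + relax lam u s E y.
  rewrite /relax -mulmxDr; congr (_ *m _); apply/matrixP => i j.
  rewrite mulmxDr; move: (_ *m x) (_ *m y) => mx my.
  rewrite !mxE; under eq_bigr do rewrite mxE.
  rewrite big_split /=; ring.
have relaxZ a x : relax lam u s E (a *: x) = a *: relax lam u s E x.
  rewrite /relax scalemxAr; congr (_ *m _); apply/matrixP => i j.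
  rewrite -scalemxAr; move: (_ *m x) => mx.
  rewrite !mxE; under eq_bigr do rewrite mxE.
  rewrite -mulr_sumr; ring.
have relax0 : relax lam u s E 0 = 0.
  by rewrite -[X in relax _ _ _ _ X](scale0r 0) relaxZ scale0r.
have -> : relax lam u s E f =
    \sum_i relax lam u s E (f i 0 *: delta_mx i 0).
  rewrite -(big_morph _ relaxD relax0) [in LHS](matrix_sum_delta f).
  by congr relax; apply: eq_bigr => i _; rewrite big_ord1.
apply/matrixP => i j; rewrite ord1 summxE mxE; apply: eq_bigr => l _.
by rewrite relaxZ !mxE mulrC.
Qed.

Lemma time_step_plane_wave lam u s E dt k fh :
  time_step lam u s E dt (plane_wave k fh) =
  plane_wave k (amplification_mx lam u s E k dt *m fh).
Proof.
apply/funext => x; apply/matrixP => j l; rewrite ord1 mxE relaxE /plane_wave.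
rewrite -scalemxAr /amplification_mx -mulmxA mul_diag_mx !mxE mulrA -expiD.
by congr (expi _ * _); rewrite /dot /=; ring.
Qed.

(* g is the eigenvalue of A close to 1: it tends to 1 and, for small dt > 0, is
   the only eigenvalue of A dt in a fixed disc around 1. *)
Definition eigenvalue_near1 (A : R -> 'M[R[i]]_4) (g : R -> R[i]) : Prop :=
  g dt @[dt --> 0^'+] --> (1 : R[i]^o) /\
  exists2 r : R, 0 < r & \forall dt \near 0^'+,
    eigenvalue (A dt) (g dt) /\
    forall z : R[i], `|z - 1| < r%:C -> eigenvalue (A dt) z -> z = g dt.

(* [lhs dt t (x, y)] is the left-hand side of the equation, with t, x, y in the
   places of the derivations in time and space. *)
Definition approaches (n : nat) (A : R * R -> R -> 'M[R[i]]_4)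
    (lhs : R -> R[i] -> R[i] * R[i] -> R[i]) : Prop :=
  forall k : R * R, exists2 g : R -> R[i], eigenvalue_near1 (A k) g &
    exists C : R, \forall dt \near 0^'+,
      `|lhs dt (clog (g dt) / dt%:C) (0 +i* k.1, 0 +i* k.2)|
        <= (C * dt ^+ n)%:C.

End Scheme.

Section Equation.
Context {R : realType}.

Definition mx22 (T : Type) (a b c d : T) : 'M[T]_2 :=
  \matrix_(i, j) tnth (tnth [tuple [tuple a; b]; [tuple c; d]] i) j.

Definition contract (A : 'M[R]_2) (B : 'M[R[i]]_2) : R[i] :=
  \sum_i \sum_j (A i j)%:C * B i j.

Definition nabla2 (d : R[i] * R[i]) : 'M[R[i]]_2 :=
  mx22 (d.1 * d.1) (d.1 * d.2)
       (d.1 * d.2) (d.2 * d.2).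

Definition nabla3 (d : R[i] * R[i]) : 'M[R[i]]_2 :=
  mx22 (d.1 * d.1 * d.1) (d.1 * d.2 * d.2)
       (d.1 * d.1 * d.2) (d.2 * d.2 * d.2).

Definition equation_lhs (V : R * R) (D2 D3 : 'M[R]_2)
    (dt : R) (t : R[i]) (d : R[i] * R[i]) : R[i] :=
  t + (V.1%:C * d.1 + V.2%:C * d.2)
    - dt%:C * contract D2 (nabla2 d)
    + dt%:C ^+ 2 * contract D3 (nabla3 d).

End Equation.

(* Main.v *)
Require Import Defs.
From mathcomp Require Import all_boot all_order all_algebra.
From mathcomp Require Import all_classical all_reals all_analysis.
From mathcomp Require Import complex ring lra.

Set Implicit Arguments.
Unset Strict Implicit.
Unset Printing Implicit Defensive.

Import Order.TTheory GRing.Theory Num.Theory.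
Import numFieldNormedType.Exports.

Local Open Scope classical_set_scope.
Local Open Scope ring_scope.
Local Open Scope complex_scope.

(** On the Fourier mode k a time step is D R, where R is the relaxation matrix
    and D the diagonal matrix of the phases exp(- dt ik.v_j).  Let w(dt) be the
    symbol obtained by solving the equation for the time derivative, with the
    gradient replaced by d = ik.  The claim is that the eigenvalue g close to 1
    satisfies log g = dt w + O(dt^4).

    Put G = exp(dt w).  Multiplied by the inverse of D, the eigenvalue equation
    D R f = G f reads  (R f)_j = exp(dt (w + d.v_j)) f_j  and involves a single
    exponential for each velocity.  Insert f = f_0 + dt f_1 + dt^2 f_2 + ...
    and take moments.  At order n the moments with s_k != 0 give those of f_n in
    terms of f_0, ..., f_(n-1), by a division by s_k ([corrector]).  The
    conserved moment gives no information on f_n; it leaves a solvability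
    condition on the previous terms.  The conditions of orders 1, 2, 3
    ([solvability1], [solvability2], [solvability3]) are what fixes the transport
    term, D2 and D3; they are identities between rational functions.  Hence the
    truncated series has total mass 1 and residual L f - G f = O(dt^4)
    ([mode_residual]).

    Such an f makes det (G - L) of order dt^4: apply the adjugate of G - L to the
    residual ([orderO_det_residual]).  In the basis of the moments R is lower
    triangular with diagonal 1, 1 - sq, 1 - sq, 1 - sxy, so that 1 is a simple
    root of its characteristic polynomial.  The characteristic polynomial of L
    is then injective near 1 with a lower Lipschitz bound uniform in dt
    ([horner_dist_ge]), which gives both the uniqueness of g and
    g - G = O(dt^4) ([simple_eigenvalue_expansion]).  Finally the principal
    logarithm is a Lipschitz inverse of exp near 1 ([orderO_clog]), and a
    division by dt turns O(dt^4) into O(dt^3). *)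

(** * Orders of magnitude as the time step tends to zero *)

Section OrderO.
Context {R : realType}.
Implicit Types (f g : R -> R[i]) (n m : nat).

(** The constant is real and the inequality is between elements of R[i], where
    the norm of R[i] takes its values. *)
Definition orderO n f : Prop :=
  exists C : R, \forall t \near 0^'+, `|f t| <= (C * t ^+ n)%:C.

Lemma ltr0C (x : R) : (0 < x%:C :> R[i]) = (0 < x).
Proof. exact: (ltcR 0 x). Qed.

Lemma orderO_pos n f : orderO n f -> exists2 C : R, 0 < C &
  \forall t \near 0^'+, `|f t| <= (C * t ^+ n)%:C.
Proof.
case=> C HC; exists (`|C| + 1); first by rewrite ltr_wpDl.
near=> t.
have t0 : 0 < t by near: t; exact: nbhs_right_gt.
have /le_trans -> // : `|f t| <= (C * t ^+ n)%:C by near: t.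
rewrite lecR ler_pM2r ?exprn_gt0 //.
by rewrite (le_trans (ler_norm C)) // lerDl.
Unshelve. all: by end_near.
Qed.

Lemma eq_orderO n f g : f =1 g -> orderO n f -> orderO n g.
Proof. by move=> /funext ->. Qed.

Lemma orderO_le n f g : (\forall t \near 0^'+, `|f t| <= `|g t|) ->
  orderO n g -> orderO n f.
Proof.
by move=> fg [C HC]; exists C; apply: filterS2 fg HC => t; exact: le_trans.
Qed.

Lemma orderOD n f g : orderO n f -> orderO n g -> orderO n (fun t => f t + g t).
Proof.
move=> [C HC] [D HD]; exists (C + D).
apply: filterS2 HC HD => t fC gD.
by rewrite mulrDl rmorphD (le_trans (ler_normD _ _)) // lerD.
Qed.

Lemma orderON n f : orderO n f -> orderO n (fun t => - f t).
Proof. by apply: orderO_le; apply: nearW => t; rewrite normrN. Qed.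

Lemma orderOB n f g : orderO n f -> orderO n g -> orderO n (fun t => f t - g t).
Proof. by move=> Hf /orderON; exact: orderOD. Qed.

Lemma orderOM n m f g :
  orderO n f -> orderO m g -> orderO (n + m) (fun t => f t * g t).
Proof.
move=> [C HC] [D HD]; exists (C * D).
apply: filterS2 HC HD => t fC gD.
by rewrite exprD mulrACA rmorphM normrM ler_pM.
Qed.

Lemma orderO_weaken n m f : (m <= n)%N -> orderO n f -> orderO m f.
Proof.
move=> mn /orderO_pos[C C0 HC]; exists C.
near=> t.
have t0 : 0 < t by near: t; exact: nbhs_right_gt.
have t1 : t < 1 by near: t; exact: nbhs_right_lt.
have /le_trans -> // : `|f t| <= (C * t ^+ n)%:C by near: t.
by rewrite lecR ler_pM2l // ler_wiXn2l // ltW.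
Unshelve. all: by end_near.
Qed.

Lemma orderO_cst (c : R[i]) : orderO 0 (fun=> c).
Proof.
exists (complex.Re `|c|); apply: nearW => t.
by rewrite expr0 mulr1 RRe_real // normr_real.
Qed.

Lemma orderO0 n : orderO n (fun=> 0).
Proof. by exists 0; apply: nearW => t; rewrite mul0r normr0. Qed.

Lemma orderO_time : orderO 1 (fun t => t%:C).
Proof.
exists 1; near=> t.
have t0 : 0 < t by near: t; exact: nbhs_right_gt.
by rewrite mul1r expr1 ger0_norm // ler0c ltW.
Unshelve. all: by end_near.
Qed.

Lemma orderOMr n f g :
  orderO n f -> orderO 0 g -> orderO n (fun t => f t * g t).
Proof. by move=> fO gO; have := orderOM fO gO; rewrite addn0. Qed.

Lemma orderOMl n f g :
  orderO 0 f -> orderO n g -> orderO n (fun t => f t * g t).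
Proof. exact: orderOM. Qed.

Lemma orderOX n m f : orderO n f -> orderO (n * m) (fun t => f t ^+ m).
Proof.
move=> Hf; elim: m => [|m IH]; first by rewrite muln0; exact: orderO_cst.
rewrite mulnS; by apply: eq_orderO (orderOM Hf IH) => t; rewrite exprS.
Qed.

Lemma orderO_sum (I : Type) (r : seq I) (P : pred I) n (F : I -> R -> R[i]) :
  (forall i, P i -> orderO n (F i)) ->
  orderO n (fun t => \sum_(i <- r | P i) F i t).
Proof.
move=> HF; elim: r => [|i r IH].
  by apply: eq_orderO (orderO0 n) => t; rewrite big_nil.
case Pi : (P i); last by apply: eq_orderO IH => t; rewrite big_cons Pi.
by apply: eq_orderO (orderOD (HF i Pi) IH) => t; rewrite big_cons Pi.
Qed.

Lemma orderO_prod (I : Type) (r : seq I) (F : I -> R -> R[i]) :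
  (forall i, orderO 0 (F i)) -> orderO 0 (fun t => \prod_(i <- r) F i t).
Proof.
move=> HF; elim: r => [|i r IH].
  by apply: eq_orderO (orderO_cst 1) => t; rewrite big_nil.
by apply: eq_orderO (orderOMl (HF i) IH) => t; rewrite big_cons.
Qed.

Lemma orderO_bounded n (c : R[i]) f :
  orderO n (fun t => f t - c) -> orderO 0 f.
Proof.
move=> /(orderO_weaken (leq0n n)) Hf.
by apply: eq_orderO (orderOD Hf (orderO_cst c)) => t; rewrite subrK.
Qed.

Lemma orderO_horner n (p : {poly R[i]}) :
  (forall i, (i < n)%N -> p`_i = 0) -> orderO n (fun t => p.[t%:C]).
Proof.
move=> p0.
apply: (@eq_orderO _ (fun t => \sum_(i < size p) p`_i * t%:C ^+ i)).
  by move=> t; rewrite horner_coef.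
apply: orderO_sum => i _; have [/p0 ->|ni] := ltnP i n.
  by apply: eq_orderO (orderO0 n) => t; rewrite mul0r.
apply: (orderOMl (orderO_cst _)); apply: orderO_weaken ni _.
by rewrite -[X in orderO X _]mul1n; apply: orderOX; exact: orderO_time.
Qed.

Lemma orderO_small n f (e : R) : (0 < n)%N -> orderO n f -> 0 < e ->
  \forall t \near 0^'+, `|f t| <= e%:C.
Proof.
move=> n0 /(orderO_weaken n0)/orderO_pos[C C0 HC] e0; near=> t.
have /le_trans -> // : `|f t| <= (C * t ^+ 1)%:C by near: t.
rewrite lecR expr1 mulrC -ler_pdivlMr // ltW //.
by near: t; apply: nbhs_right_lt; rewrite divr_gt0.
Unshelve. all: by end_near.
Qed.

Lemma orderO_norm n (f : R -> R[i]) : orderO n f -> orderO n (fun t => `|f t|).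
Proof. by apply: orderO_le; apply: nearW => t; rewrite normr_id. Qed.

Lemma orderO_div n (f : R -> R[i]) :
  orderO n.+1 f -> orderO n (fun t => f t / t%:C).
Proof.
move=> [C HC]; exists C; apply: filterS2 HC (nbhs_right_gt 0) => t tC t0.
have t0C : 0 < t%:C by rewrite ltr0C.
rewrite normrM normfV (gtr0_norm t0C) ler_pdivrMr // -rmorphM.
by rewrite -mulrA -exprSr.
Qed.

End OrderO.

(** * Taylor expansions of order three *)

Section Taylor.
Context {R : realType}.
Implicit Types (x : R).

(** Mean value theorem.  Starting from bounds on exp, sin and cos, it yields
    their Taylor remainders, each being a primitive of another one. *)
Lemma le_norm_primitive (F F' : R -> R) (C : R) n :
  (forall x, is_derive x 1 F (F' x)) -> F 0 = 0 ->
  (forall x, `|x| <= 1 -> `|F' x| <= C * `|x| ^+ n) ->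
  forall x, `|x| <= 1 -> `|F x| <= C * `|x| ^+ n.+1.
Proof.
move=> dF F0 HC x x1.
have cF y : {for y, continuous F}.
  by apply: differentiable_continuous; apply/derivable1_diffP; case: (dF y).
suff [c cx ->] : exists2 c, `|c| <= `|x| & F x = F' c * x.
  rewrite normrM exprSr mulrA ler_wpM2r ?normr_ge0 //.
  apply: le_trans (HC c (le_trans cx x1)) _.
  have C0 : 0 <= C.
    have := HC 1; rewrite normr1 expr1n mulr1 => /(_ (lexx _)).
    exact: le_trans.
  by rewrite ler_wpM2l // lerXn2r // nnegrE.
have [x0|/ltW x0] := leP 0 x.
  have [|c] := @MVT_segment R F F' 0 x x0.
    by apply: continuous_subspaceT => y; exact: cF.
  rewrite in_itv /= F0 !subr0 => /andP[c0 cx] ->.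
  by exists c => //; rewrite !ger0_norm.
have [|c] := @MVT_segment R F F' x 0 x0.
  by apply: continuous_subspaceT => y; exact: cF.
rewrite in_itv /= F0 sub0r => /andP[cx c0] /eqP.
rewrite sub0r mulrN eqr_opp => /eqP ->.
by exists c => //; rewrite !ler0_norm // lerN2.
Qed.

Lemma expR_taylor x : `|x| <= 1 ->
  `|expR x - (1 + x + x ^+ 2 / 2 + x ^+ 3 / 6)| <= expR 1 * `|x| ^+ 4.
Proof.
move: x.
have E0 x : `|x| <= 1 -> `|expR x| <= expR 1 * `|x| ^+ 0.
  move=> x1; rewrite expr0 mulr1 ger0_norm ?expR_ge0 //.
  by rewrite ler_expR (le_trans (ler_norm x)).
have E1 x : `|x| <= 1 -> `|expR x - 1| <= expR 1 * `|x| ^+ 1.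
  move: x; apply: (@le_norm_primitive _ expR) => //.
  - by move=> x; apply: is_derive_eq; rewrite subr0.
  - by rewrite expR0 subrr.
have E2 x : `|x| <= 1 -> `|expR x - (1 + x)| <= expR 1 * `|x| ^+ 2.
  move: x; apply: (@le_norm_primitive _ (fun x => expR x - 1)) => //.
  - by move=> x; apply: is_derive_eq; rewrite add0r.
  - by rewrite expR0 addr0 subrr.
have E3 x : `|x| <= 1 ->
    `|expR x - (1 + x + x ^+ 2 / 2)| <= expR 1 * `|x| ^+ 3.
  move: x; apply: (@le_norm_primitive _ (fun x => expR x - (1 + x))) => //.
  - by move=> x; apply: is_derive_eq; rewrite /GRing.scale /=; field.
  - by rewrite expR0 expr0n /= mul0r !addr0 subrr.
apply: (@le_norm_primitive _ (fun x => expR x - (1 + x + x ^+ 2 / 2))) => //.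
- by move=> x; apply: is_derive_eq; rewrite /GRing.scale /=; field.
- by rewrite expR0 !expr0n /= !mul0r !addr0 subrr.
Qed.

Lemma cos_sin_taylor x : `|x| <= 1 ->
  `|cos x - (1 - x ^+ 2 / 2)| <= `|x| ^+ 4 /\
  `|sin x - (x - x ^+ 3 / 6)| <= `|x| ^+ 4.
Proof.
have S1 (y : R) : `|y| <= 1 -> `|sin y| <= 1 * `|y| ^+ 1.
  move: y; apply: (@le_norm_primitive sin cos); first by rewrite sin0.
  - by move=> y _; rewrite expr0 mulr1 cos_max.
have C1 (y : R) : `|y| <= 1 -> `|cos y - 1| <= 1 * `|y| ^+ 2.
  move: y; apply: (@le_norm_primitive _ (fun x => - sin x)).
  - by move=> y; apply: is_derive_eq; rewrite subr0.
  - by rewrite cos0 subrr.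
  - by move=> y /S1; rewrite normrN.
have S2 (y : R) : `|y| <= 1 -> `|sin y - y| <= 1 * `|y| ^+ 3.
  move: y; apply: (@le_norm_primitive _ (fun x => cos x - 1)).
  - by rewrite sin0 subrr.
  - exact: C1.
have C2 (y : R) : `|y| <= 1 -> `|cos y - (1 - y ^+ 2 / 2)| <= 1 * `|y| ^+ 4.
  move: y; apply: (@le_norm_primitive _ (fun x => - (sin x - x))).
  - by move=> y; apply: is_derive_eq; rewrite /GRing.scale /=; field.
  - by rewrite cos0 expr0n /= mul0r subr0 subrr.
  - by move=> y /S2; rewrite normrN.
have S3 (y : R) : `|y| <= 1 -> `|sin y - (y - y ^+ 3 / 6)| <= 1 * `|y| ^+ 5.
  move: y; apply: (@le_norm_primitive _ (fun x => cos x - (1 - x ^+ 2 / 2))).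
  - by move=> y; apply: is_derive_eq; rewrite /GRing.scale /=; field.
  - by rewrite sin0 expr0n /= mul0r !subr0.
  - exact: C2.
move=> x1; split; first by have := C2 x x1; rewrite mul1r.
apply: le_trans (S3 x x1) _; rewrite mul1r.
by rewrite ler_wiXn2l ?normr_ge0.
Qed.

End Taylor.

(** * The complex exponential *)

Section Cexp.
Context {R : realType}.
Implicit Types (x : R) (z w : R[i]).

Definition cexp z : R[i] :=
  (expR (complex.Re z))%:C * expi (complex.Im z).

Lemma cexpD z w : cexp (z + w) = cexp z * cexp w.
Proof.
rewrite /cexp; case: z w => [a b] [c d] /=.
by rewrite expRD expiD rmorphM mulrACA.
Qed.

Lemma expiE x : expi x = (cos x)%:C + 'i%C * (sin x)%:C.
Proof. exact: complexE. Qed.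

Lemma expi_cexp x : expi x = cexp ('i%C * x%:C).
Proof.
rewrite /cexp /= !(mul0r, mulr0, mul1r, oppr0, subr0, addr0, add0r).
by rewrite expR0 mul1r.
Qed.

Lemma normr_expi x : `|expi x| = 1 :> R[i].
Proof. by rewrite normc_def /= cos2Dsin2 sqrtr1. Qed.

Lemma normr_cexp z : `|cexp z| = (expR (complex.Re z))%:C.
Proof.
by rewrite normrM normr_expi mulr1 ger0_norm // ler0c expR_ge0.
Qed.

Lemma normr_realC x : `|x%:C| = `|x|%:C :> R[i].
Proof. by rewrite normc_def /= expr0n addr0 sqrtr_sqr. Qed.

Lemma normr_imaginary : `|'i%C| = 1 :> R[i].
Proof. by rewrite normc_def /= expr0n expr1n add0r sqrtr1. Qed.

Lemma normr_Im_le z : (`|complex.Im z|)%:C <= `|z|.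
Proof.
have := normc_ge_Re (z * 'i%C).
by rewrite ReiNIm normrN normrM normr_imaginary mulr1.
Qed.

Lemma normr_le_ReIm z : `|z| <= (`|complex.Re z| + `|complex.Im z|)%:C.
Proof.
rewrite {1}(complexE z) rmorphD (le_trans (ler_normD _ _)) // lerD //.
  by rewrite normr_realC.
by rewrite normrM normr_imaginary mul1r normr_realC.
Qed.

Lemma orderO_real_comp n (h : R -> R) (C : R) (x : R -> R) :
  (forall y, `|y| <= 1 -> `|h y| <= C * `|y| ^+ n) ->
  orderO 1 (fun t => (x t)%:C) -> orderO n (fun t => (h (x t))%:C).
Proof.
move=> hC xO.
apply: (@orderO_le _ _ _ (fun t => C%:C * (x t)%:C ^+ n)); last first.
  apply: orderOMl (orderO_cst _) _.
  by rewrite -[X in orderO X _]mul1n; apply: orderOX.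
apply: filterS (orderO_small (ltn0Sn 0) xO ltr01) => t.
rewrite -rmorphXn -rmorphM !normr_realC !lecR => /hC /le_trans -> //.
rewrite normrM normrX ler_wpM2r ?exprn_ge0 ?normr_ge0 //.
exact: ler_norm.
Qed.

(** The Taylor bounds on exp, cos and sin give the expansion of exp (a) and of
    exp (i b); that of exp (a + i b) is their product. *)
Lemma orderO_cexp (z : R -> R[i]) : orderO 1 z ->
  orderO 4 (fun t => cexp (z t) - (1 + z t + z t ^+ 2 / 2 + z t ^+ 3 / 6)).
Proof.
move=> zO.
pose a t := complex.Re (z t); pose b t := complex.Im (z t).
have aO : orderO 1 (fun t => (a t)%:C).
  apply: orderO_le zO; apply: nearW => t.
  by rewrite normr_realC normc_ge_Re.
have bO : orderO 1 (fun t => (b t)%:C).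
  apply: orderO_le zO; apply: nearW => t.
  by rewrite normr_realC normr_Im_le.
have ibO : orderO 1 (fun t => 'i%C * (b t)%:C).
  exact: orderOMl (orderO_cst _) bO.
pose T (u : R[i]) := 1 + u + u ^+ 2 / 2 + u ^+ 3 / 6.
have eO : orderO 4 (fun t => (expR (a t))%:C - T (a t)%:C).
  apply: eq_orderO (orderO_real_comp (@expR_taylor R) aO) => t.
  by rewrite /T; field.
have cO : orderO 4 (fun t => (cos (b t) - (1 - b t ^+ 2 / 2))%:C).
  apply: (@orderO_real_comp 4 (fun x => cos x - (1 - x ^+ 2 / 2)) 1 b) => // x.
  by move=> /cos_sin_taylor[+ _]; rewrite mul1r.
have sO : orderO 4 (fun t => (sin (b t) - (b t - b t ^+ 3 / 6))%:C).
  apply: (@orderO_real_comp 4 (fun x => sin x - (x - x ^+ 3 / 6)) 1 b) => // x.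
  by move=> /cos_sin_taylor[_]; rewrite mul1r.
have iO : orderO 4 (fun t => expi (b t) - T ('i%C * (b t)%:C)).
  apply: eq_orderO (orderOD cO (orderOMl (orderO_cst 'i%C) sO)) => t.
  rewrite expiE /T.
  have i2 := @sqr_i R.
  have i3 : 'i%C ^+ 3 = - 'i%C :> R[i] by rewrite exprS i2 mulrN1.
  by rewrite !exprMn i2 i3; field.
have TO u : orderO 1 u -> orderO 0 (fun t => T (u t)).
  move=> uO; have u0 := orderO_weaken (leq0n 1) uO.
  rewrite /T; apply: orderOD; last exact: orderOMr (orderOX 3 u0) (orderO_cst _).
  apply: orderOD; last exact: orderOMr (orderOX 2 u0) (orderO_cst _).
  by apply: orderOD u0; exact: orderO_cst.
(* The exponential law holds for T up to the six monomials of degree >= 4. *)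
have TD (u v : R -> R[i]) : orderO 1 u -> orderO 1 v ->
    orderO 4 (fun t => T (u t) * T (v t) - T (u t + v t)).
  move=> uO vO.
  have H i j : (4 <= i + j)%N -> orderO 4 (fun t => u t ^+ i * v t ^+ j).
    move=> ij; apply: orderO_weaken ij _.
    rewrite -[X in (X + _)%N]mul1n -[X in (_ + X)%N]mul1n.
    by apply: orderOM; apply: orderOX.
  have K c i j : (4 <= i + j)%N ->
      orderO 4 (fun t => c * (u t ^+ i * v t ^+ j)).
    by move=> ij; apply: orderOMl (orderO_cst _) (H _ _ ij).
  have := orderOD (K 6^-1 1%N 3%N isT) (orderOD (K 4^-1 2%N 2%N isT)
    (orderOD (K 6^-1 3%N 1%N isT) (orderOD (K 12^-1 2%N 3%N isT)
    (orderOD (K 12^-1 3%N 2%N isT) (K 36^-1 3%N 3%N isT))))).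
  by apply: eq_orderO => // t; rewrite /T; field.
have iTO := TO _ ibO; have iEO := orderOD (orderO_weaken (leq0n 4) iO) iTO.
have := orderOD (orderOD (orderOM eO iEO) (orderOMl (TO _ aO) iO))
  (TD _ _ aO ibO).
apply: eq_orderO => t.
by rewrite -complexE /cexp -/(T _) -/(a t) -/(b t); ring.
Qed.

Lemma orderO_cexpB1 (z : R -> R[i]) : orderO 1 z ->
  orderO 1 (fun t => cexp (z t) - 1).
Proof.
move=> zO; have zX m c : (0 < m)%N -> orderO 1 (fun t => c * z t ^+ m).
  move=> m0; apply: orderOMl (orderO_cst _) _.
  by apply: orderO_weaken m0 _; rewrite -[X in orderO X _]mul1n; exact: orderOX.
have O4 := orderO_weaken (isT : (1 <= 4)%N) (orderO_cexp zO).
have := orderOD O4 (orderOD zO (orderOD (zX 2%N 2^-1 isT) (zX 3%N 6^-1 isT))).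
by apply: eq_orderO => t; ring.
Qed.

End Cexp.

(** * The logarithm as a local inverse of the exponential *)

Section Clog.
Context {R : realType}.
Implicit Types (x : R) (z w : R[i]).

Lemma cexp_clog z : z != 0 -> cexp (clog z) = z.
Proof. exact: clogK. Qed.

Lemma cos_lt1_small (e : R) : 0 < e <= pi -> cos e < 1.
Proof.
move=> /andP[e0 epi]; rewrite -[X in _ < X]cos0 ltr_cos // in_itv /=.
  by rewrite lexx pi_ge0.
by rewrite (ltW e0).
Qed.

Lemma norm_Im_clog z : z != 0 -> `|complex.Im (clog z)| <= pi.
Proof.
case: z => a b; rewrite eq_complex /= => z0.
have n_gt0 : 0 < Num.sqrt (a ^+ 2 + b ^+ 2).
  rewrite sqrtr_gt0 lt_neqAle addr_ge0 ?sqr_ge0 // andbT eq_sym.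
  by rewrite paddr_eq0 ?sqr_ge0 // !sqrf_eq0.
set n := Num.sqrt _ in n_gt0 *.
have an : -1 <= a / n <= 1.
  rewrite -ler_norml normrM normfV (gtr0_norm n_gt0) ler_pdivrMr // mul1r.
  by rewrite -sqrtr_sqr ler_wsqrtr // lerDl sqr_ge0.
suff : `|acos (a / n)| <= pi by case: ifP; rewrite ?normrN.
by rewrite ger0_norm ?acos_ge0 ?acos_lepi.
Qed.

(** Close to 1 the cosine of the argument, Re z / |z|, exceeds cos (1 / 2).  As
    the argument lies in [-pi, pi], where cos is injective up to sign, it is then
    small: this is where the choice of the principal branch is used. *)
Lemma Im_clog_small : exists2 d : R, 0 < d & forall z,
  `|z - 1| <= d%:C -> `|complex.Im (clog z)| <= 2^-1.
Proof.
have pi2 : 2^-1 <= pi :> R by have := pi_ge2 R; lra.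
pose k : R := cos 2^-1.
have k1 : k < 1 by apply: cos_lt1_small; rewrite pi2 andbT; lra.
have k0 : 0 < k by apply: cos_gt0_pihalf; have := pihalf_ge1 R; lra.
exists ((1 - k) / 2); first lra.
move=> z zd.
have z0 : z != 0.
  apply: contraTneq zd => ->; rewrite sub0r normrN normr1.
  by rewrite -(rmorph1 (real_complex R)) lecR -ltNge; lra.
have zE := cexp_clog z0.
set y := complex.Im _ in zE *; pose r := expR (complex.Re (clog z)).
have ReE : complex.Re z = r * cos y.
  by rewrite -zE /cexp /expi /= -/r -/y !mul0r subr0.
have rE : `|z| = r%:C by rewrite -[z]zE normr_cexp.
have r_le : r <= 1 + (1 - k) / 2.
  rewrite -lecR -rE rmorphD rmorph1 -lerBlDl.
  by rewrite (le_trans _ zd) // -[X in _ - X](normr1 R[i]) lerB_dist.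
have Re_ge : 1 - (1 - k) / 2 <= complex.Re z.
  have : (`|complex.Re (z - 1)|)%:C <= ((1 - k) / 2)%:C.
    exact: le_trans (normc_ge_Re _) zd.
  rewrite lecR raddfB /= ler_norml => /andP[+ _]; lra.
have r_gt0 : 0 < r by exact: expR_gt0.
have cosy : k <= cos y.
  have : r * k <= r * cos y.
    rewrite -ReE (le_trans _ Re_ge) //.
    have : r * k <= (1 + (1 - k) / 2) * k by rewrite ler_pM2r.
    have := sqr_ge0 (1 - k); nra.
  by rewrite ler_pM2l.
have ypi : `|y| <= pi by exact: norm_Im_clog.
rewrite leNgt; apply/negP => y2; move: cosy.
rewrite -[cos y]cos_norm leNgt ltr_cos ?y2 //.
  by rewrite in_itv /= pi2 andbT; lra.
by rewrite in_itv /= normr_ge0.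
Qed.

Lemma norm_le_sin (y : R) : `|y| <= 1 -> cos 1 * `|y| <= `|sin y|.
Proof.
wlog y0 : y / 0 <= y => [H y1|].
  have [/H ->//|/ltW yN] := leP 0 y.
  by have := H (- y); rewrite sinN !normrN oppr_ge0; apply.
rewrite ger0_norm // => y1.
have [|c] := @MVT_segment R sin cos 0 y y0.
  exact/continuous_subspaceT/continuous_sin.
rewrite in_itv /= sin0 !subr0 => /andP[c0 cy] ->.
have cc : cos 1 <= cos c.
  have [c1|c1] := ltP c 1; last by rewrite (_ : c = 1) //; apply/le_anti; lra.
  have := pi_ge2 R => p2.
  by rewrite ltW // ltr_cos // in_itv /=; lra.
apply: le_trans (ler_norm _); exact: ler_wpM2r.
Qed.

(** The modulus of exp w controls the real part of w, and its imaginary part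
    controls sin (Im w), hence Im w as long as it stays in [-1, 1]. *)
Lemma norm_le_cexpB1 w (e : R) : e <= 2^-1 -> `|complex.Im w| <= 1 ->
  `|cexp w - 1| <= e%:C -> `|w| <= ((2 + 2 / cos 1) * e)%:C.
Proof.
move=> e2 w1 we.
have e0 : 0 <= e by rewrite -ler0c (le_trans _ we).
have k0 := @cos1_gt0 R.
set x := complex.Re w; set y := complex.Im w in w1 *.
have xe : `|expR x - 1| <= e.
  have := ler_dist_dist (cexp w) 1.
  rewrite normr_cexp normr1 -[X in _ - X](rmorph1 (real_complex R)) -rmorphB.
  by rewrite normr_realC => /le_trans /(_ we); rewrite lecR.
have se : expR x * `|sin y| <= e.
  have := le_trans (normr_Im_le _) we; rewrite lecR raddfB /= !mul0r.
  by rewrite -/x -/y addr0 subr0 normrM (ger0_norm (expR_ge0 _)).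
have x2 : 2^-1 <= expR x by move: xe; rewrite ler_norml => /andP[]; lra.
have sy : `|sin y| <= 2 * e.
  have := ler_wpM2r (normr_ge0 (sin y)) x2; lra.
have ye : `|y| <= 2 / cos 1 * e.
  rewrite mulrAC ler_pdivlMr // mulrC (le_trans _ sy) //; exact: norm_le_sin.
have xx : `|x| <= 2 * e.
  rewrite ler_norml; apply/andP; split; last first.
    have := expR_ge1Dx x; move: xe; rewrite ler_norml => /andP[]; lra.
  have := expR_ge1Dx (- x); rewrite expRN => H.
  have : (expR x)^-1 <= 1 + 2 * e.
    rewrite -[_^-1]mul1r ler_pdivrMr ?expR_gt0 //.
    have : (1 + 2 * e) * (1 - e) <= (1 + 2 * e) * expR x.
      rewrite ler_wpM2l //; first lra.
      by move: xe; rewrite ler_norml => /andP[]; lra.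
    nra.
  lra.
apply: le_trans (normr_le_ReIm _) _; rewrite lecR -/x -/y; lra.
Qed.

(** Since z = exp (clog z), the difference z - exp w is exp w times
    exp (clog z - w) - 1, and the previous lemma applies to clog z - w. *)
Lemma clog_cexp_dist : exists L : R, exists2 d : R, 0 < d & forall z w,
  `|z - 1| <= d%:C -> `|w| <= d%:C -> `|z - cexp w| <= d%:C ->
  `|clog z - w| <= L%:C * `|z - cexp w|.
Proof.
have [d d0 Hd] := Im_clog_small; have k0 := @cos1_gt0 R.
pose D := Num.min d 4^-1; have [Dd D4] : D <= d /\ D <= 4^-1.
  by rewrite /D !ge_min !lexx orbT.
exists ((2 + 2 / cos 1) * 2), D; first by rewrite lt_min d0 invr_gt0 ltr0n.
move=> z w z1 w1 zw.
have z0 : z != 0.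
  apply: contraTneq z1 => ->; rewrite sub0r normrN normr1.
  by rewrite -(rmorph1 (real_complex R)) lecR -ltNge; lra.
have Dz : `|z - 1| <= d%:C by rewrite (le_trans z1) // lecR.
have Rw : `|complex.Re w| <= 4^-1.
  by rewrite -lecR (le_trans (normc_ge_Re _)) // (le_trans w1) // lecR.
have Iw : `|complex.Im w| <= 4^-1.
  by rewrite -lecR (le_trans (normr_Im_le _)) // (le_trans w1) // lecR.
have [e eE] : exists e, `|z - cexp w| = e%:C.
  by exists (complex.Re `|z - cexp w|); rewrite RRe_real // normr_real.
rewrite eE; rewrite eE lecR in zw.
have E : cexp w * (cexp (clog z - w) - 1) = z - cexp w.
  by rewrite mulrBr mulr1 -cexpD addrCA subrr addr0 cexp_clog.
have H1 : `|cexp (clog z - w) - 1| <= (2 * e)%:C.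
  have /(congr1 Num.norm) := E; rewrite eE normrM normr_cexp => H.
  have : (2^-1)%:C * `|cexp (clog z - w) - 1| <= e%:C.
    rewrite -H ler_wpM2r // lecR (le_trans _ (expR_ge1Dx _)) //.
    move: Rw; rewrite ler_norml => /andP[]; lra.
  by rewrite rmorphM fmorphV ler_pdivrMl // ltcR.
have := norm_le_cexpB1 _ _ H1; rewrite mulrA -rmorphM; apply; first lra.
rewrite raddfB /= (le_trans (ler_normB _ _)) //.
have := Hd z Dz; lra.
Qed.

Lemma orderO_clog n (z w : R -> R[i]) : (0 < n)%N -> orderO 1 w ->
  orderO 1 (fun t => z t - 1) -> orderO n (fun t => z t - cexp (w t)) ->
  orderO n (fun t => clog (z t) - w t).
Proof.
move=> n0 wO zO zwO; have [L [d d0 H]] := clog_cexp_dist.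
apply: orderO_le (orderOMl (orderO_cst L%:C) zwO).
apply: filterS3 (orderO_small (ltn0Sn 0) wO d0) (orderO_small (ltn0Sn 0) zO d0)
  (orderO_small n0 zwO d0) => t wt zt zwt.
apply: le_trans (H _ _ zt wt zwt) _.
by rewrite normrM ler_wpM2r // normr_realC lecR ler_norm.
Qed.

End Clog.

(** * Perturbation of a simple eigenvalue *)

Lemma horner_char_poly (F : comNzRingType) n (A : 'M[F]_n) (z : F) :
  (char_poly A).[z] = \det (z%:M - A).
Proof.
rewrite /char_poly -horner_evalE -det_map_mx; congr (\det _).
apply/matrixP => i j; rewrite !mxE.
by rewrite /= horner_evalE hornerD hornerN hornerC hornerMn hornerX.
Qed.

(** The modulus of p(0) is the product of those of the roots, and the smallest
    factor is at most their geometric mean. *)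
Lemma exists_small_root (C : numClosedFieldType) (p : {poly C}) n :
  p \is monic -> size p = n.+2 ->
  exists2 z, root p z & `|z| ^+ n.+1 <= `|p.[0]|.
Proof.
move=> pm sp; have [r pE] := closed_field_poly_normal p.
rewrite (monicP pm) scale1r in pE.
have sr : size r = n.+1 by move: sp; rewrite pE size_prod_XsubC => -[].
suff [z zr zle] : exists2 z, z \in r & `|z| ^+ size r <= \prod_(x <- r) `|x|.
  exists z; first by rewrite pE root_prod_XsubC.
  rewrite -sr (le_trans zle) // pE horner_prod normr_prod le_eqVlt.
  apply/orP; left; apply/eqP; apply: eq_bigr => x _.
  by rewrite hornerXsubC sub0r normrN.
have : r != [::] by rewrite -size_eq0 sr.
elim: r {pE sr} => // x [|y r] IH _.
  by exists x; rewrite ?inE // big_cons big_nil mulr1 expr1.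
have [//|z zr zle] := IH.
rewrite big_cons; have /orP[xz|zx] := real_leVge (normr_real x) (normr_real z).
  exists x; rewrite ?inE ?eqxx // exprS ler_wpM2l // (le_trans _ zle) //.
  by rewrite lerXn2r // nnegrE.
exists z; first by rewrite inE zr orbT.
by rewrite exprS ler_pM // exprn_ge0.
Qed.

(** The quotient of p(h) - p(h') by h - h' is the linear coefficient of p plus
    terms that vanish at h = h' = 0.  The radius on which the bound is useful
    depends on p only through B and the linear coefficient, so that it is uniform
    over a family of polynomials that varies with the time step. *)
Lemma horner_dist_ge (C : numClosedFieldType) (p : {poly C}) n (B r h h' : C) :
  (size p <= n)%N -> (forall i, `|p`_i| <= B) ->
  `|h| <= r -> `|h'| <= r -> r <= 1 ->
  (`|p`_1| - (B * (n%:R * r)) *+ n) * `|h - h'| <= `|p.[h] - p.[h']|.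
Proof.
move=> sp pB hr h'r r1.
have r0 : 0 <= r := le_trans (normr_ge0 h) hr.
pose S i := \sum_(j < i) h ^+ (i.-1 - j) * h' ^+ j.
have pE : p.[h] - p.[h'] = (h - h') * \sum_(i < n) p`_i * S i.
  rewrite !(horner_coef_wide _ sp) -sumrB mulr_sumr; apply: eq_bigr => i _.
  by rewrite -mulrBr subrXX mulrCA.
have SE i : (i < n)%N -> `|S i - (i == 1%N)%:R| <= n%:R * r.
  case: i => [|[|i]] i_n; rewrite /S.
  - by rewrite big_ord0 subr0 normr0 mulr_ge0 ?ler0n.
  - by rewrite big_ord1 mulr1 subrr normr0 mulr_ge0 ?ler0n.
  rewrite subr0 (le_trans (ler_norm_sum _ _ _)) //.
  apply: (@le_trans _ _ (\sum_(j < i.+2) r)); last first.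
    by rewrite sumr_const card_ord -[r *+ _]mulr_natl ler_wpM2r // ler_nat ltnW.
  apply: ler_sum => j _; rewrite normrM !normrX.
  have H (x : C) m : `|x| <= r -> `|x| ^+ m <= 1.
    by move=> xr; rewrite exprn_ile1 // (le_trans xr).
  have [j0|j0] := posnP j.
    rewrite j0 expr0 mulr1 subn0 /= exprS.
    by rewrite -[r]mulr1 ler_pM ?exprn_ge0 ?H.
  rewrite -(prednK j0) [X in _ * X]exprS mulrCA -[r]mulr1.
  rewrite ler_pM ?mulr_ge0 ?exprn_ge0 //.
  by rewrite -[1]mulr1 ler_pM ?exprn_ge0 ?H.
rewrite pE normrM mulrC ler_wpM2l //.
have -> : \sum_(i < n) p`_i * S i =
    p`_1 - \sum_(i < n) p`_i * ((i == 1%N :> nat)%:R - S i).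
  have -> : p`_1 = \sum_(i < n) p`_i * (i == 1%N :> nat)%:R.
    have [n1|n1] := ltnP 1 n.
      rewrite (bigD1 (Ordinal n1)) //= mulr1 big1 ?addr0 // => i.
      by rewrite -val_eqE /= => /negPf ->; rewrite mulr0.
    rewrite nth_default ?(leq_trans sp) // big1 // => i _.
    by have := ltn_ord i; case: eqP => [->|_]; rewrite ?mulr0 // ltnNge n1.
  by rewrite -sumrB; apply: eq_bigr => i _; rewrite mulrBr subKr.
apply: le_trans (lerB_dist _ _); rewrite lerD2l lerN2.
apply: le_trans (ler_norm_sum _ _ _) _.
have -> : (B * (n%:R * r)) *+ n = \sum_(i < n) B * (n%:R * r).
  by rewrite sumr_const card_ord.
apply: ler_sum => i _; rewrite normrM ler_pM //; by rewrite distrC SE.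
Qed.

Section Perturbation.
Context {R : realType}.

Definition poly_close (p : R -> {poly R[i]}) (q : {poly R[i]}) :=
  forall i, orderO 1 (fun t => (p t)`_i - q`_i).

Lemma poly_closeC q : poly_close (fun=> q) q.
Proof. by move=> i; apply: eq_orderO (orderO0 1) => t; rewrite subrr. Qed.

Lemma poly_closeM p q p' q' : poly_close p p' -> poly_close q q' ->
  poly_close (fun t => p t * q t) (p' * q').
Proof.
move=> pp qq i.
apply: (@eq_orderO _ _ (fun t => \sum_(j < i.+1)
   (((p t)`_j - p'`_j) * (q t)`_(i - j)
    + p'`_j * ((q t)`_(i - j) - q'`_(i - j))))).
  by move=> t; rewrite !coefM -sumrB; apply: eq_bigr => j _; ring.
apply: orderO_sum => j _; apply: orderOD; last exact: orderOMl (orderO_cst _) _.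
by apply: orderOMr; last exact: orderO_bounded (qq _).
Qed.

Lemma poly_close_sum (I : Type) (r : seq I) (p : I -> R -> {poly R[i]}) q :
  (forall i, poly_close (p i) (q i)) ->
  poly_close (fun t => \sum_(i <- r) p i t) (\sum_(i <- r) q i).
Proof.
move=> pq k.
apply: (@eq_orderO _ _ (fun t => \sum_(i <- r) ((p i t)`_k - (q i)`_k))).
  by move=> t; rewrite !coef_sum sumrB.
by apply: orderO_sum => i _; exact: pq.
Qed.

Lemma poly_close_prod (I : Type) (r : seq I) (p : I -> R -> {poly R[i]}) q :
  (forall i, poly_close (p i) (q i)) ->
  poly_close (fun t => \prod_(i <- r) p i t) (\prod_(i <- r) q i).
Proof.
move=> pq; elim: r => [|i r IH].
  rewrite big_nil (_ : (fun _ => _) = fun=> 1); first exact: poly_closeC.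
  by apply/funext => t; rewrite big_nil.
rewrite big_cons (_ : (fun _ => _) = fun t => p i t * \prod_(j <- r) p j t).
  exact: poly_closeM.
by apply/funext => t; rewrite big_cons.
Qed.

Lemma poly_close_char_poly n (A : R -> 'M[R[i]]_n) (A0 : 'M[R[i]]_n) :
  (forall i j, orderO 1 (fun t => A t i j - A0 i j)) ->
  poly_close (fun t => char_poly (A t)) (char_poly A0).
Proof.
move=> AO.
have entry i j :
    poly_close (fun t => char_poly_mx (A t) i j) (char_poly_mx A0 i j).
  move=> k; have kO : orderO 1 (fun t => (A0 i j - A t i j) * (k == 0%N)%:R).
    apply: orderOMr (orderO_cst _).
    by apply: eq_orderO (orderON (AO i j)) => t; rewrite opprB.
  apply: eq_orderO kO => t; rewrite !mxE !coefB !coefC.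
  by case: eqP => _; rewrite ?mulr1 ?mulr0; ring.
apply: poly_close_sum => s; apply: poly_closeM; first exact: poly_closeC.
by apply: poly_close_prod => i; exact: entry.
Qed.

Lemma orderO_det n (A : R -> 'M[R[i]]_n) :
  (forall i j, orderO 0 (fun t => A t i j)) -> orderO 0 (fun t => \det (A t)).
Proof.
move=> AO; apply: orderO_sum => s _; apply: orderOMl; first exact: orderO_cst.
by apply: orderO_prod => i.
Qed.

Lemma orderO_adj n (A : R -> 'M[R[i]]_n) i j :
  (forall i j, orderO 0 (fun t => A t i j)) ->
  orderO 0 (fun t => (\adj (A t)) i j).
Proof.
move=> AO.
apply: (@eq_orderO _ _ (fun t => cofactor (A t) j i)).
  by move=> t; rewrite !mxE.
apply: orderOMl; first exact: orderO_cst.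
apply: orderO_det => k l; apply: eq_orderO (AO (lift j k) (lift i l)) => t.
by rewrite !mxE.
Qed.

(** The adjugate of A sends A f to (det A) f, whose entries sum to det A. *)
Lemma orderO_det_residual n N (A : R -> 'M[R[i]]_n) (f : R -> 'cV_n) :
  (forall i j, orderO 0 (fun t => A t i j)) ->
  (forall t, \sum_i f t i 0 = 1) ->
  (forall i, orderO N (fun t => (A t *m f t) i 0)) ->
  orderO N (fun t => \det (A t)).
Proof.
move=> AO f1 rO.
apply: (@eq_orderO _ _ (fun t =>
  \sum_i \sum_j (\adj (A t)) i j * (A t *m f t) j 0)).
  move=> t; rewrite -[RHS]mulr1 -(f1 t) mulr_sumr; apply: eq_bigr => i _.
  have := congr1 (fun M : 'cV_n => M i 0) (mulmxA (\adj (A t)) (A t) (f t)).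
  by rewrite mul_adj_mx mul_scalar_mx !mxE.
apply: orderO_sum => i _; apply: orderO_sum => j _.
by apply: orderOMl (rO j); exact: orderO_adj.
Qed.

End Perturbation.

Section Simple.
Context {R : realType}.

(** A normalised approximate eigenvector determines the eigenvalue near a simple
    one up to the order of its residual.  The hypotheses on the coefficients of
    the characteristic polynomial of A0 - 1 say that 1 is a simple eigenvalue of
    A0; working with A - 1 puts the root of interest at 0. *)
Theorem simple_eigenvalue_expansion n N (A : R -> 'M[R[i]]_n.+1)
    (A0 : 'M[R[i]]_n.+1) (G : R -> R[i]) (f : R -> 'cV[R[i]]_n.+1) :
  (forall i j, orderO 1 (fun t => A t i j - A0 i j)) ->
  (char_poly (A0 - 1%:M))`_0 = 0 -> (char_poly (A0 - 1%:M))`_1 != 0 ->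
  orderO 1 (fun t => G t - 1) ->
  (forall t, \sum_i f t i 0 = 1) ->
  (forall i, orderO N (fun t => (A t *m f t) i 0 - G t * f t i 0)) ->
  exists g : R -> R[i], [/\ g t @[t --> 0^'+] --> (1 : R[i]^o),
    exists2 r : R, 0 < r & \forall t \near 0^'+, eigenvalue (A t) (g t) /\
      forall z : R[i], `|z - 1| < r%:C -> eigenvalue (A t) z -> z = g t
    & orderO N (fun t => g t - G t)].
Proof.
move=> AO P00 P01 GO f1 resO.
pose P t := char_poly (A t - 1%:M); pose P0 := char_poly (A0 - 1%:M).
have PO : poly_close P P0.
  apply: poly_close_char_poly => i j; apply: eq_orderO (AO i j) => t.
  by rewrite !mxE; ring.
have PE t z : (P t).[z - 1] = \det (z%:M - A t).
  by rewrite horner_char_poly raddfB /= opprB addrA subrK.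
have eigE t z : eigenvalue (A t) z = root (P t) (z - 1).
  by rewrite eigenvalue_root_char rootE horner_char_poly -PE.
have sP t : size (P t) = n.+2 by rewrite size_char_poly.
have [B B0 PB] : exists2 B : R, 0 < B &
    \forall t \near 0^'+, forall i, `|(P t)`_i| <= B%:C.
  have : orderO 0 (fun t => \sum_(i < n.+2) `|(P t)`_i|).
    by apply: orderO_sum => i _; apply/orderO_norm/(orderO_bounded (PO i)).
  case/orderO_pos=> B B0 HB; exists B => //; apply: filterS HB => t.
  rewrite expr0 mulr1 ger0_norm ?sumr_ge0 // => HB i.
  have [i_n|n_i] := ltnP i n.+2; last first.
    by rewrite nth_default ?sP // normr0 ler0c ltW.
  apply: le_trans HB; rewrite (bigD1 (Ordinal i_n)) //= lerDl.
  exact: sumr_ge0.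
have [c c0 cE] : exists2 c : R, 0 < c & `|P0`_1| = c%:C.
  have cE : (complex.Re `|P0`_1|)%:C = `|P0`_1|.
    by rewrite RRe_real // normr_real.
  by exists (complex.Re `|P0`_1|) => //; rewrite -ltr0C cE normr_gt0.
pose K : R := n.+2%:R * (B * n.+2%:R).
have K0 : 0 < K by rewrite !mulr_gt0 ?ltr0n.
pose r : R := Num.min 1 (c / (4 * K)).
have r0 : 0 < r by rewrite lt_min ltr01 divr_gt0 // mulr_gt0.
have r1 : r <= 1 by rewrite ge_min lexx.
have rK : K * r <= c / 4.
  have : r <= c / (4 * K) by rewrite ge_min lexx orbT.
  rewrite ler_pdivlMr ?mulr_gt0 //; lra.
(* the radius r makes the nonlinear terms of P t smaller than c / 4 *)
have P_inj : \forall t \near 0^'+, forall h h', `|h| <= r%:C -> `|h'| <= r%:C ->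
    (c / 2)%:C * `|h - h'| <= `|(P t).[h] - (P t).[h']|.
  have c4 : 0 < c / 4 by rewrite divr_gt0.
  apply: filterS2 PB (orderO_small (ltn0Sn 0) (PO 1%N) c4).
  move=> t tB t1 h h' hr h'r.
  have r1C : r%:C <= 1 by rewrite -(rmorph1 (real_complex R)) lecR.
  apply: le_trans (horner_dist_ge (eq_leq (sP t)) tB hr h'r r1C).
  rewrite ler_wpM2r //.
  have -> : (B%:C * (n.+2%:R * r%:C)) *+ n.+2 = (K * r)%:C.
    by rewrite -mulr_natl /K !rmorphM !rmorph_nat; ring.
  have Pt1 : (c - c / 4)%:C <= `|(P t)`_1|.
    have : `|P0`_1| - (c / 4)%:C <= `|(P t)`_1|.
      by rewrite lerBlDl -lerBlDr (le_trans _ t1) // distrC lerB_dist.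
    by apply: le_trans; rewrite cE -(rmorphB (real_complex R)).
  apply: (@le_trans _ _ ((c - c / 4)%:C - (K * r)%:C)); last by rewrite lerD2r.
  by rewrite -rmorphB lecR; lra.
have [h hP] : {h : R -> R[i] & forall t,
    root (P t) (h t) /\ `|h t| ^+ n.+1 <= `|(P t).[0]|}.
  apply: (@choice _ _ (fun t z => root (P t) z /\ `|z| ^+ n.+1 <= `|(P t).[0]|)).
  move=> t; have [z] := exists_small_root (char_poly_monic _) (sP t).
  by exists z.
have h_small e : 0 < e -> \forall t \near 0^'+, `|h t| <= e%:C.
  move=> e0; have P0O : orderO 1 (fun t => (P t).[0]).
    have P0_0 : P0`_0 = 0 := P00.
    by apply: eq_orderO (PO 0%N) => t; rewrite P0_0 subr0 horner_coef0.
  have := orderO_small (ltn0Sn 0) P0O (exprn_gt0 n.+1 e0).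
  apply: filterS => t te; have /le_trans/(_ te) := (hP t).2.
  rewrite rmorphXn ler_pXn2r // nnegrE ?normr_ge0 // ler0c; exact: ltW.
exists (fun t => h t + 1); split.
- suff : ((fun t => h t + 1) : R -> R[i]^o) @ 0^'+ --> (1 : R[i]^o) by [].
  apply/cvgrPdist_le => e e0.
  have eE : (complex.Re e)%:C = e by rewrite RRe_real // gtr0_real.
  have := h_small (complex.Re e); rewrite -ltr0C eE => /(_ e0).
  by apply: filterS => t; rewrite opprD addrCA subrr addr0 normrN.
- exists r => //; apply: filterS2 P_inj (h_small r r0) => t inj hr.
  split=> [|z zr]; first by rewrite eigE addrK (hP t).1.
  rewrite eigE => /eqP Pz; have /eqP Ph := (hP t).1.
  have := inj (z - 1) (h t) (ltW zr) hr.
  rewrite Pz Ph subrr normr0 pmulr_rle0 ?ltr0C ?divr_gt0 // normr_le0 subr_eq0.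
  by move=> /eqP <-; rewrite subrK.
have detO : orderO N (fun t => \det ((G t)%:M - A t)).
  apply: (@orderO_det_residual _ _ _ _ f) => // [i j|i].
    apply: (@eq_orderO _ _ (fun t => G t * (i == j)%:R - A t i j)).
      by move=> t; rewrite !mxE mulr_natr.
    apply: orderOB; last exact: orderO_bounded (AO i j).
    by apply: orderOMl (orderO_cst _); exact: orderO_bounded GO.
  apply: eq_orderO (orderON (resO i)) => t.
  by rewrite opprB mulmxBl mul_scalar_mx !mxE.
apply: orderO_le (orderOMl (orderO_cst (c / 2)^-1%:C) detO).
apply: filterS3 P_inj (h_small r r0) (orderO_small (ltn0Sn 0) GO r0).
move=> t inj hr Gr.
have := inj (h t) (G t - 1) hr Gr; rewrite PE.
have /eqP -> := (hP t).1; rewrite sub0r normrN => H.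
rewrite (_ : h t + 1 - G t = h t - (G t - 1)); last by ring.
rewrite normrM normr_realC [`|(c / 2)^-1|]ger0_norm; last first.
  by rewrite invr_ge0 divr_ge0 ?(ltW c0).
by rewrite fmorphV ler_pdivlMl // ltr0C divr_gt0.
Qed.

End Simple.

(** * Formal expansion of the eigenvector *)

(** The expansion is algebraic in the space derivatives d1, d2, whose values are
    arbitrary here.  A distribution is seen as a function of the velocity
    (x, y). *)
Section FormalExpansion.
Variable F : numFieldType.
Variables (lam Vx Vy ux uy d1 d2 sq sxy : F).
Hypotheses (lam0 : lam != 0) (sq0 : sq != 0) (sxy0 : sxy != 0).
Implicit Types (x y : F) (h c : F -> F -> F) (k : 'I_4).

Definition vsum h :=
  h lam lam + h (- lam) lam + h (- lam) (- lam) + h lam (- lam).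

Definition cmoment k x y : F :=
  tnth [tuple 1; x - ux; y - uy; (x - ux) * (y - uy)] k.
Definition relaxation k : F := tnth [tuple 0; sq; sq; sxy] k.
Definition equilibrium k : F :=
  tnth [tuple 1; Vx - ux; Vy - uy; (Vx - ux) * (Vy - uy)] k.

(** The inverse of the moment matrix: mx, my and mxy are the moments with respect
    to the unshifted polynomials X, Y and XY, which are orthogonal on the four
    velocities. *)
Definition of_moments (m0 m1 m2 m3 : F) x y :=
  let mx := m1 + ux * m0 in let my := m2 + uy * m0 in
  let mxy := m3 + ux * m2 + uy * m1 + ux * uy * m0 in
  (m0 + x * mx / lam ^+ 2 + y * my / lam ^+ 2 + x * y * mxy / lam ^+ 4) / 4.

Lemma cmoment_of_moments m0 m1 m2 m3 k :
  vsum (fun x y => cmoment k x y * of_moments m0 m1 m2 m3 x y) =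
  tnth [tuple m0; m1; m2; m3] k.
Proof.
rewrite /vsum /cmoment /of_moments !(tnth_nth 0).
by case: k => -[|[|[|[|//]]]] ? /=; field.
Qed.

Lemma vsum_of_moments m0 m1 m2 m3 : vsum (of_moments m0 m1 m2 m3) = m0.
Proof.
have := cmoment_of_moments m0 m1 m2 m3 ord0.
by rewrite /vsum /cmoment !(tnth_nth 0) /= !mul1r.
Qed.

Let sigq := sq^-1 - 2^-1.
Let sigxy := sxy^-1 - 2^-1.

(** The coefficients of w = symbol1 + dt symbol2 + dt^2 symbol3, the symbol of
    the equation solved for the time derivative. *)
Definition symbol1 := - (Vx * d1 + Vy * d2).
Definition symbol2 :=
  sigq * ((lam ^+ 2 - Vx ^+ 2) * d1 ^+ 2 + (lam ^+ 2 - Vy ^+ 2) * d2 ^+ 2).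
Definition symbol3 := - (
    Vx / 6 * (lam ^+ 2 - Vx ^+ 2) * (1 - 12 * sigq ^+ 2) * d1 ^+ 3
  + 2 * sigq * (lam ^+ 2 - Vy ^+ 2) * (ux - Vx) * (sigq - sigxy) * (d1 * d2 ^+ 2)
  + 2 * sigq * (lam ^+ 2 - Vx ^+ 2) * (uy - Vy) * (sigq - sigxy) * (d1 ^+ 2 * d2)
  + Vy / 6 * (lam ^+ 2 - Vy ^+ 2) * (1 - 12 * sigq ^+ 2) * d2 ^+ 3).

(** Taylor coefficients in dt of exp (dt (w + d.v)) for the velocity v = (x, y). *)
Definition exponent1 x y := symbol1 + (d1 * x + d2 * y).
Definition exp_coef2 x y := exponent1 x y ^+ 2 / 2 + symbol2.
Definition exp_coef3 x y :=
  exponent1 x y ^+ 3 / 6 + exponent1 x y * symbol2 + symbol3.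

(** With c the contribution of the previous terms to the current order, the
    distribution of total mass 0 that balances the moments of c with s_k != 0. *)
Definition corrector c := of_moments 0
  (- vsum (fun x y => (x - ux) * c x y) / sq)
  (- vsum (fun x y => (y - uy) * c x y) / sq)
  (- vsum (fun x y => (x - ux) * (y - uy) * c x y) / sxy).

(** The row of the conserved moment reads 0 = vsum c. *)
Lemma corrector_balance c k : vsum c = 0 ->
  vsum (fun x y => cmoment k x y * (corrector c x y + c x y)) =
  (1 - relaxation k) * vsum (fun x y => cmoment k x y * corrector c x y)
  + relaxation k * equilibrium k * vsum (corrector c).
Proof.
move=> c0; rewrite vsum_of_moments mulr0 addr0.
have -> : vsum (fun x y => cmoment k x y * (corrector c x y + c x y)) =
    vsum (fun x y => cmoment k x y * corrector c x y)
    + vsum (fun x y => cmoment k x y * c x y) by rewrite /vsum; ring.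
rewrite mulrBl mul1r; congr (_ + _); rewrite cmoment_of_moments.
rewrite /relaxation /cmoment !(tnth_nth 0).
case: k => -[|[|[|[|//]]]] ? /=;
  rewrite ?[sq * _]mulrC ?[sxy * _]mulrC ?divfK ?opprK //.
by rewrite mul0r oppr0 -c0 /vsum !mul1r.
Qed.

(** The leading term is the equilibrium distribution of mass 1. *)
Definition mode0 := of_moments 1 (Vx - ux) (Vy - uy) ((Vx - ux) * (Vy - uy)).
Definition defect1 x y := exponent1 x y * mode0 x y.
Definition mode1 := corrector defect1.
Definition defect2 x y := exponent1 x y * mode1 x y + exp_coef2 x y * mode0 x y.
Definition mode2 := corrector defect2.
Definition defect3 x y :=
  exponent1 x y * mode2 x y + exp_coef2 x y * mode1 x y
  + exp_coef3 x y * mode0 x y.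
Definition mode3 := corrector defect3.

(** The equilibrium is a product distribution in which the twist u no longer
    appears. *)
Lemma mode0E x y :
  mode0 x y = (1 + x * Vx / lam ^+ 2) * (1 + y * Vy / lam ^+ 2) / 4.
Proof. by rewrite /mode0 /of_moments; field. Qed.

(** Order 1: the mean of v under the equilibrium distribution is V. *)
Lemma solvability1 : vsum defect1 = 0.
Proof.
by rewrite /vsum /defect1 !mode0E /exponent1 /symbol1; field.
Qed.

(** Order 2 determines the diffusion D2.  Its off-diagonal part vanishes because
    the equilibrium makes the two coordinates of v independent. *)
Lemma solvability2 : vsum defect2 = 0.
Proof.
rewrite /vsum /defect2 /mode1 /corrector /of_moments /vsum /defect1 !mode0E.
rewrite /exp_coef2 /exponent1 /symbol2 /symbol1 /sigq.
by field; rewrite lam0 sq0 sxy0.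
Qed.

(** Order 3 determines D3; the twist and sxy enter through the moment of
    XY of [mode1]. *)
Lemma solvability3 : vsum defect3 = 0.
Proof.
rewrite /vsum /defect3 /mode2 /corrector /of_moments /vsum.
rewrite /defect2 /mode1 /corrector /of_moments /vsum /defect1 !mode0E.
rewrite /exp_coef3 /exp_coef2 /exponent1.
rewrite /symbol3 /symbol2 /symbol1 /sigq /sigxy.
by field; rewrite lam0 sq0 sxy0.
Qed.

Definition exp_coef n x y :=
  nth 0 [:: 1; exponent1 x y; exp_coef2 x y; exp_coef3 x y] n.
Definition mode_coef n x y :=
  nth 0 [:: mode0 x y; mode1 x y; mode2 x y; mode3 x y] n.

Lemma vsum_mode n : vsum (mode_coef n) = (n == 0%N)%:R.
Proof.
case: n => [|[|[|[|n]]]]; rewrite /mode_coef /=; try exact: vsum_of_moments.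
by rewrite nth_nil /vsum !addr0.
Qed.

(** The equation R f = exp (dt (w + d.v)) f, in moments, at the orders 0 to 3. *)
Lemma mode_balance k n : (n < 4)%N ->
  vsum (fun x y => cmoment k x y *
                   \sum_(l < n.+1) exp_coef l x y * mode_coef (n - l) x y) =
  (1 - relaxation k) * vsum (fun x y => cmoment k x y * mode_coef n x y)
  + relaxation k * equilibrium k * vsum (mode_coef n).
Proof.
have step m (c : F -> F -> F) : vsum c = 0 ->
    mode_coef m =2 corrector c ->
    (forall x y, \sum_(l < m.+1) exp_coef l x y * mode_coef (m - l) x y =
                 corrector c x y + c x y) ->
    vsum (fun x y => cmoment k x y *
                     \sum_(l < m.+1) exp_coef l x y * mode_coef (m - l) x y) =
    (1 - relaxation k) * vsum (fun x y => cmoment k x y * mode_coef m x y)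
    + relaxation k * equilibrium k * vsum (mode_coef m).
  by move=> c0 mc sc; have := corrector_balance k c0; rewrite /vsum !mc !sc.
case: n => [|[|[|[|//]]]] _.
- have -> : vsum (fun x y => cmoment k x y *
                   \sum_(l < 1) exp_coef l x y * mode_coef (0 - l) x y) =
            vsum (fun x y => cmoment k x y * mode0 x y).
    by rewrite /vsum !big_ord1 /= !mul1r.
  rewrite vsum_mode mulr1 cmoment_of_moments -/(equilibrium k); ring.
- apply: (step _ _ solvability1) => // x y.
  rewrite !big_ord_recr big_ord0 /= /exp_coef /mode_coef /=.
  by rewrite -/mode1 /defect1; ring.
- apply: (step _ _ solvability2) => // x y.
  rewrite !big_ord_recr big_ord0 /= /exp_coef /mode_coef /=.
  by rewrite -/mode2 /defect2; ring.
- apply: (step _ _ solvability3) => // x y.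
  rewrite !big_ord_recr big_ord0 /= /exp_coef /mode_coef /=.
  by rewrite -/mode3 /defect3; ring.
Qed.

End FormalExpansion.

(** * The relaxation matrix *)

Lemma char_poly_conj (F : fieldType) n (P B : 'M[F]_n) : P \in unitmx ->
  char_poly (invmx P *m B *m P) = char_poly B.
Proof.
move=> Pu; pose c (M : 'M[F]_n) := map_mx polyC M.
have PP : c (invmx P) *m c P = 1%:M by rewrite -map_mxM mulVmx // map_mx1.
have -> : char_poly (invmx P *m B *m P) =
    \det (c (invmx P) *m char_poly_mx B *m c P).
  rewrite mulmxBr mulmxBl scalar_mxC -[_%:M *m _ *m _]mulmxA PP mulmx1.
  by rewrite /c -!map_mxM.
by rewrite !det_mulmx mulrAC -det_mulmx PP det1 mul1r.
Qed.

Section Scheme.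
Context {R : realType}.
Implicit Types (lam : R) (u : R * R) (s E : 4.-tuple R).

(** The relaxation in the basis of the moments.  The column l = 0 carries the
    equilibrium, because the moment of index 0 is the density. *)
Definition moment_relax_mx s E : 'M[R[i]]_4 := \matrix_(k, l)
  ((1 - (tnth s k)%:C) *+ (k == l) + (tnth s k)%:C * (tnth E k)%:C *+ (l == 0)).

Lemma sum_moment_mx lam u (f : 'cV[R[i]]_4) :
  (moment_mx lam u *m f) 0 0 = \sum_j f j 0.
Proof.
rewrite mxE; apply: eq_bigr => j _.
by rewrite mxE /moment_poly (tnth_nth 0) /= mul1r.
Qed.

Lemma moment_relax_mxE lam u s E (f : 'cV[R[i]]_4) (k : 'I_4) :
  let m := moment_mx lam u *m f in
  (moment_relax_mx s E *m m) k 0 =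
  (1 - (tnth s k)%:C) * m k 0 + (tnth s k)%:C * (tnth E k)%:C * \sum_j f j 0.
Proof.
move=> m; rewrite -(sum_moment_mx lam u) -/m mxE.
under eq_bigr do rewrite mxE mulrDl mulrnAl mulrnAl.
rewrite big_split /=; congr (_ + _).
  rewrite (bigD1 k) //= eqxx big1 ?addr0 // => l; rewrite eq_sym => /negPf ->.
  by rewrite mulr0n.
rewrite (bigD1 0) //= big1 ?addr0 // => l /negPf ->.
by rewrite mulr0n.
Qed.

Lemma relax_mxE lam u s E : relax_mx lam u s E =
  invmx (moment_mx lam u) *m moment_relax_mx s E *m moment_mx lam u.
Proof.
apply/matrixP => i j; rewrite mxE /relax -!mulmxA.
rewrite -[RHS]mulr1.
transitivity ((invmx (moment_mx lam u) *m
   (moment_relax_mx s E *m (moment_mx lam u *m delta_mx j 0))) i (0 : 'I_1)).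
  congr ((_ *m _) i _); apply/matrixP => k l.
  by rewrite ord1 moment_relax_mxE !mxE; ring.
by rewrite !mulmxA -colE mxE mulr1.
Qed.

Lemma char_poly_relax_mx lam u (sq sxy e1 e2 e3 : R) : lam != 0 ->
  char_poly (relax_mx lam u [tuple 0; sq; sq; sxy] [tuple 1; e1; e2; e3] - 1%:M) =
  'X * ('X + sq%:C%:P) ^+ 2 * ('X + sxy%:C%:P).
Proof.
move=> lam0; have Mu := moment_mx_unit u lam0.
rewrite relax_mxE -[X in _ - X](mulVmx Mu) -[X in _ - X *m _]mulmx1.
rewrite -mulmxBl -mulmxBr char_poly_conj // char_poly_trig.
  rewrite !big_ord_recr big_ord0 /= !mxE !(tnth_nth 0) /=.
  rewrite !mulr1n !mulr0n !addr0 mul1r rmorph0 rmorph1.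
  rewrite subr0 mul0r addr0 subrr polyC0 subr0.
  by rewrite ![1 - _ - 1]addrAC !subrr !sub0r !polyCN !opprK; ring.
apply/is_trig_mxP => i j ij; rewrite !mxE.
have /negPf ijn : i != j by rewrite neq_ltn ij.
have /negPf j0 : j != 0 by rewrite -lt0n (leq_trans _ ij).
by rewrite ijn j0 !mulr0n addr0 subrr.
Qed.

End Scheme.

(** * The approximate eigenvector of the scheme *)

Section Residual.
Context {R : realType}.
Variables (lam : R) (V u : R * R) (sq sxy : R) (k : R * R).
Hypotheses (lam_gt0 : 0 < lam) (sq_neq0 : sq != 0) (sxy_neq0 : sxy != 0).

Let velC (j : 'I_4) : R[i] * R[i] :=
  ((velocity lam j).1%:C, (velocity lam j).2%:C).
Let d1 : R[i] := 0 +i* k.1.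
Let d2 : R[i] := 0 +i* k.2.

Lemma sum_velocity (h : R[i] -> R[i] -> R[i]) :
  \sum_j h (velC j).1 (velC j).2 = vsum lam%:C h.
Proof.
rewrite !big_ord_recr big_ord0 /velC /velocity !(tnth_nth 0) /= add0r.
by rewrite !rmorphN.
Qed.

Lemma taylor3_coef (a b c : R[i]) i : (i < 4)%N ->
  let p := Poly [:: 0; a; b; c] in
  (1 + p + 2^-1 *: p ^+ 2 + 6^-1 *: p ^+ 3)`_i =
  nth 0 [:: 1; a; a ^+ 2 / 2 + b; a ^+ 3 / 6 + a * b + c] i.
Proof.
move=> i4 p; rewrite !coefD !coefZ coef1 [p ^+ 3]exprS !expr2.
case: i i4 => [|[|[|[|//]]]] _;
  rewrite !(coefM, big_ord_recr, big_ord0, coef_Poly) /=; by field.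
Qed.

Definition dispersion (t : R) : R[i] :=
  symbol1 V.1%:C V.2%:C d1 d2
  + t%:C * symbol2 lam%:C V.1%:C V.2%:C d1 d2 sq%:C
  + t%:C ^+ 2 * symbol3 lam%:C V.1%:C V.2%:C u.1%:C u.2%:C d1 d2 sq%:C sxy%:C.

Definition mode_poly (j : 'I_4) : {poly R[i]} := \poly_(n < 4)
  mode_coef lam%:C V.1%:C V.2%:C u.1%:C u.2%:C d1 d2 sq%:C sxy%:C
    n (velC j).1 (velC j).2.

Definition mode (t : R) : 'cV[R[i]]_4 := \col_j (mode_poly j).[t%:C].

Definition exponent (j : 'I_4) : {poly R[i]} := Poly [:: 0;
  exponent1 V.1%:C V.2%:C d1 d2 (velC j).1 (velC j).2;
  symbol2 lam%:C V.1%:C V.2%:C d1 d2 sq%:C;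
  symbol3 lam%:C V.1%:C V.2%:C u.1%:C u.2%:C d1 d2 sq%:C sxy%:C].

Lemma horner_exponent j t :
  (exponent j).[t%:C] =
    t%:C * dispersion t + 'i%C * (t * dot k (velocity lam j))%:C.
Proof.
have dE (x : R) : 0 +i* x = 'i%C * x%:C.
  by rewrite (complexE (0 +i* x)) /= add0r.
have d1E : d1 = 'i%C * k.1%:C := dE k.1.
have d2E : d2 = 'i%C * k.2%:C := dE k.2.
have -> : 'i%C * (t * dot k (velocity lam j))%:C =
    t%:C * (d1 * (velC j).1 + d2 * (velC j).2).
  rewrite d1E d2E /dot [(velC j).1]/= [(velC j).2]/=.
  by rewrite !(rmorphM, rmorphD); ring.
rewrite /exponent horner_Poly /dispersion /exponent1.
move: (symbol1 _ _ _ _) (symbol2 _ _ _ _ _ _) (symbol3 _ _ _ _ _ _ _ _ _).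
by move=> s1 s2 s3; rewrite [horner_rec _ _]/=; ring.
Qed.

Lemma sum_mode t : \sum_j mode t j 0 = 1.
Proof.
under eq_bigr do rewrite mxE; rewrite -horner_sum.
suff -> : \sum_j mode_poly j = 1 by rewrite hornerC.
have lam0 : lam%:C != 0 by rewrite fmorph_eq0 gt_eqF.
apply/polyP => n; rewrite coef_sum coef1.
under eq_bigr do rewrite coef_poly.
case: ltnP => n4; last by rewrite big1 //; case: n n4.
by rewrite (sum_velocity (mode_coef _ _ _ _ _ _ _ _ _ n)) vsum_mode.
Qed.

Let s := [tuple 0; sq; sq; sxy].
Let E := [tuple 1; V.1 - u.1; V.2 - u.2; (V.1 - u.1) * (V.2 - u.2)].

Lemma moment_mx_velC l j :
  moment_mx lam u l j = cmoment u.1%:C u.2%:C l (velC j).1 (velC j).2.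
Proof.
rewrite mxE /moment_poly /cmoment !(tnth_nth 0).
by case: l => -[|[|[|[|//]]]] ? //=; rewrite ?rmorphM !rmorphB.
Qed.

Lemma relaxation_tnth l : (tnth s l)%:C = relaxation sq%:C sxy%:C l.
Proof.
by rewrite /relaxation !(tnth_nth 0); case: l => -[|[|[|[|//]]]] ?.
Qed.

Lemma equilibrium_tnth l :
  (tnth E l)%:C = equilibrium V.1%:C V.2%:C u.1%:C u.2%:C l.
Proof.
rewrite /equilibrium !(tnth_nth 0).
by case: l => -[|[|[|[|//]]]] ? //=; rewrite ?rmorphM !rmorphB.
Qed.

(** Replacing the exponential by its Taylor polynomial of degree 3 leaves a
    polynomial in t, whose coefficients of degree less than 4 vanish by
    [mode_balance]. *)
Lemma moment_residual l : orderO 4 (fun t =>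
  (moment_mx lam u *m \col_j (cexp (exponent j).[t%:C] * mode t j 0)) l 0
  - (moment_relax_mx s E *m (moment_mx lam u *m mode t)) l 0).
Proof.
have lam0 : lam%:C != 0 by rewrite fmorph_eq0 gt_eqF.
have sq0 : sq%:C != 0 by rewrite fmorph_eq0.
have sxy0 : sxy%:C != 0 by rewrite fmorph_eq0.
pose M j := cmoment u.1%:C u.2%:C l (velC j).1 (velC j).2.
pose T j := 1 + exponent j + 2^-1 *: exponent j ^+ 2 + 6^-1 *: exponent j ^+ 3.
pose Q := \sum_j M j *: (T j * mode_poly j)
  - ((1 - (tnth s l)%:C) *: (\sum_j M j *: mode_poly j)
     + ((tnth s l)%:C * (tnth E l)%:C) *: (\sum_j mode_poly j)).
have QO : orderO 4 (fun t => Q.[t%:C]).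
  apply: orderO_horner => n n4; rewrite /Q coefB coefD !coefZ !coef_sum.
  under eq_bigr do rewrite coefZ coefM.
  under [X in _ - (_ * X + _)]eq_bigr do rewrite coefZ coef_poly n4.
  under [X in _ - (_ + _ * X)]eq_bigr do rewrite coef_poly n4.
  have -> : \sum_j M j * \sum_(m < n.+1) (T j)`_m * (mode_poly j)`_(n - m) =
     \sum_j M j * \sum_(m < n.+1)
        exp_coef lam%:C V.1%:C V.2%:C u.1%:C u.2%:C d1 d2 sq%:C sxy%:C
          m (velC j).1 (velC j).2 *
        mode_coef lam%:C V.1%:C V.2%:C u.1%:C u.2%:C d1 d2 sq%:C sxy%:C
          (n - m) (velC j).1 (velC j).2.
    apply: eq_bigr => j _; congr (_ * _); apply: eq_bigr => m _.
    have m4 : (m < 4)%N by rewrite (leq_trans (ltn_ord m)).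
    rewrite coef_poly (leq_ltn_trans (leq_subr _ _) n4).
    by rewrite (taylor3_coef _ _ _ m4).
  have := mode_balance V.1%:C V.2%:C u.1%:C u.2%:C d1 d2 lam0 sq0 sxy0 l n4.
  rewrite -!sum_velocity -relaxation_tnth -equilibrium_tnth => H.
  by apply/eqP; rewrite subr_eq0; apply/eqP; exact: H.
have expO j : orderO 4 (fun t => cexp (exponent j).[t%:C] - (T j).[t%:C]).
  have : orderO 1 (fun t => (exponent j).[t%:C]).
    by apply: orderO_horner => -[|//] _; rewrite coef_Poly.
  move/orderO_cexp; apply: eq_orderO => t.
  rewrite /T; move: (exponent j) => p.
  by rewrite !(hornerD, hornerZ, horner_exp, hornerC); field.
have modeO j : orderO 0 (fun t => (mode_poly j).[t%:C]) by exact: orderO_horner.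
have : orderO 4 (fun t => \sum_j M j *
    ((cexp (exponent j).[t%:C] - (T j).[t%:C]) * (mode_poly j).[t%:C]) + Q.[t%:C]).
  apply: orderOD QO; apply: orderO_sum => j _; apply: orderOMl (orderO_cst _) _.
  by rewrite -[4%N]addn0; apply: orderOM.
apply: eq_orderO => t; rewrite moment_relax_mxE mxE [(_ *m mode t) l 0]mxE.
rewrite /Q !(hornerD, hornerN, hornerZ, horner_sum) addrA -big_split /=.
congr (_ - (_ * _ + _ * _)); apply: eq_bigr => j _.
- rewrite moment_mx_velC -/(M j) hornerZ hornerM !mxE.
  move: (M j) (cexp _) (T j) (mode_poly j) => m c p q; ring.
- by rewrite moment_mx_velC hornerZ mxE.
- by rewrite mxE.
Qed.

Let A := amplification_mx lam u s E k.
Let G t := cexp (t%:C * dispersion t).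

Lemma orderO_exponent : orderO 1 (fun t => t%:C * dispersion t).
Proof.
apply: (@eq_orderO _ _ (fun t => ('X * Poly [:: symbol1 V.1%:C V.2%:C d1 d2;
  symbol2 lam%:C V.1%:C V.2%:C d1 d2 sq%:C;
  symbol3 lam%:C V.1%:C V.2%:C u.1%:C u.2%:C d1 d2 sq%:C sxy%:C]).[t%:C])).
  move=> t; rewrite hornerM hornerX horner_Poly /dispersion.
  move: (symbol1 _ _ _ _) (symbol2 _ _ _ _ _ _) (symbol3 _ _ _ _ _ _ _ _ _).
  by move=> s1 s2 s3; rewrite [horner_rec _ _]/=; ring.
by apply: orderO_horner => -[|//] _; rewrite coefXM.
Qed.

Lemma orderO_phase j :
  orderO 1 (fun t => expi (- (t * dot k (velocity lam j))) - 1).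
Proof.
set c := dot _ _.
have zO : orderO 1 (fun t : R => 'i%C * (- (t * c))%:C).
  apply: (@eq_orderO _ _ (fun t : R => (- 'i%C * c%:C) * t%:C)).
    by move=> t; rewrite rmorphN rmorphM; ring.
  exact: orderOMl (orderO_cst _) orderO_time.
by apply: eq_orderO (orderO_cexpB1 zO) => t; rewrite expi_cexp.
Qed.

Lemma orderO_amplification i j :
  orderO 1 (fun t => A t i j - relax_mx lam u s E i j).
Proof.
apply: (@eq_orderO _ _ (fun t => (expi (- (t * dot k (velocity lam i))) - 1)
  * relax_mx lam u s E i j)).
  by move=> t; rewrite /A /amplification_mx mul_diag_mx !mxE mulrBl mul1r.
by apply: orderOMr (orderO_cst _); exact: orderO_phase.
Qed.

(** Both the inverse of the moment matrix and the phases are bounded, so that the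
    residual in moments controls that of the eigenvalue equation. *)
Lemma mode_residual i :
  orderO 4 (fun t => (A t *m mode t) i 0 - G t * mode t i 0).
Proof.
pose M := moment_mx lam u.
have Mu : M \in unitmx by apply: moment_mx_unit; rewrite gt_eqF.
pose h t : 'cV[R[i]]_4 := \col_j (cexp (exponent j).[t%:C] * mode t j 0).
pose r t := M *m h t - moment_relax_mx s E *m (M *m mode t).
have subE (X Y : 'cV[R[i]]_4) l : (X - Y) l 0 = X l 0 - Y l 0.
  by rewrite !mxE.
have hO : orderO 4 (fun t => (invmx M *m r t) i 0).
  apply: (@eq_orderO _ _ (fun t => \sum_l invmx M i l * r t l 0)).
    by move=> t; rewrite mxE.
  apply: orderO_sum => l _; apply: orderOMl (orderO_cst _) _.
  by apply: eq_orderO (moment_residual l) => t; rewrite /r subE.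
have phaseO : orderO 0 (fun t => - expi (- (t * dot k (velocity lam i)))).
  exact: orderON (orderO_bounded (orderO_phase i)).
apply: eq_orderO (orderOMl phaseO hO) => t.
rewrite /r mulmxBr !mulmxA mulVmx // mul1mx -relax_mxE.
rewrite /A /amplification_mx -mulmxA mul_diag_mx.
rewrite subE [h t i 0]mxE [X in _ = X - _]mxE [X in _ = X * _ - _]mxE.
rewrite horner_exponent cexpD -expi_cexp -/(G t).
set a := t * _; have aN : expi (- a) * expi a = 1.
  by rewrite -expiD addNr /expi cos0 sin0.
rewrite mulrBr !mulNr opprK addrC; congr (_ - _).
by rewrite mulrA [G t * _]mulrC mulrA aN mul1r.
Qed.

Lemma amplification_expansion : exists2 g, eigenvalue_near1 A g &
  orderO 4 (fun t => clog (g t) - t%:C * dispersion t).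
Proof.
have WO := orderO_exponent; have GO := orderO_cexpB1 WO.
have chi : char_poly (relax_mx lam u s E - 1%:M) =
    'X * ('X + sq%:C%:P) ^+ 2 * ('X + sxy%:C%:P).
  by apply: char_poly_relax_mx; rewrite gt_eqF.
have chi0 : (char_poly (relax_mx lam u s E - 1%:M))`_0 = 0.
  by rewrite chi -mulrA coefXM.
have chi1 : (char_poly (relax_mx lam u s E - 1%:M))`_1 != 0.
  rewrite chi -mulrA coefXM /= -horner_coef0 !hornerE.
  by rewrite !mulf_neq0 ?expf_neq0 ?fmorph_eq0.
have [g [g1 gE gO]] := simple_eigenvalue_expansion orderO_amplification
  chi0 chi1 GO sum_mode mode_residual.
have gO1 : orderO 1 (fun t => g t - 1).
  have := orderOD (orderO_weaken (isT : (1 <= 4)%N) gO) GO.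
  by apply: eq_orderO => t; ring.
by exists g => //; exact: orderO_clog WO gO1 gO.
Qed.

End Residual.

Theorem proposition2p1 (R : realType) (lam : R) (V u : R * R) (sq sxy : R)
    (lam_gt0 : 0 < lam) (sq_neq0 : sq != 0) (sxy_neq0 : sxy != 0) :
  let sigq := 1 / sq - 1 / 2 in
  let sigxy := 1 / sxy - 1 / 2 in
  let s := [tuple 0; sq; sq; sxy] in
  let E := [tuple 1; V.1 - u.1; V.2 - u.2; (V.1 - u.1) * (V.2 - u.2)] in
  let D2 := sigq *: mx22 (lam ^+ 2 - V.1 ^+ 2) 0
                         0 (lam ^+ 2 - V.2 ^+ 2) in
  let D3 :=
    mx22 (V.1 / 6 * (lam ^+ 2 - V.1 ^+ 2) * (1 - 12 * sigq ^+ 2))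
         (2 * sigq * (lam ^+ 2 - V.2 ^+ 2) * (u.1 - V.1) * (sigq - sigxy))
         (2 * sigq * (lam ^+ 2 - V.1 ^+ 2) * (u.2 - V.2) * (sigq - sigxy))
         (V.2 / 6 * (lam ^+ 2 - V.2 ^+ 2) * (1 - 12 * sigq ^+ 2)) in
  approaches 3 (amplification_mx lam u s E) (equation_lhs V D2 D3).
Proof.
move=> sigq sigxy s E D2 D3 k.
have [g g1 gO] := amplification_expansion V u k lam_gt0 sq_neq0 sxy_neq0.
exists g => //; have [C HC] := orderO_div gO; exists C.
apply: filterS2 HC (nbhs_right_gt 0) => t tC t0.
move: tC; congr (`|_| <= _).
rewrite mulrBl mulrAC divff ?mul1r; last by rewrite fmorph_eq0 gt_eqF.
rewrite /equation_lhs -!addrA; congr (_ + _).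
rewrite /dispersion /Defs.contract !big_ord_recl !big_ord0 /D2 /D3.
rewrite /mx22 /nabla2 /nabla3 !mxE !(tnth_nth 0) /=.
move: (0 +i* k.1) (0 +i* k.2) => d1 d2.
rewrite /symbol1 /symbol2 /symbol3 /sigq /sigxy.
by field; rewrite !fmorph_eq0 sq_neq0 sxy_neq0.
Qed.
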